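(* Let $n\ge 2$ be a natural number and let $\sum_{m=1}^{\infty} a_m$ be a conditionally convergent series of real numbers $a_m$. For each $\sigma\in \mathrm{Sym}(n)$, let $\big(s_k^{(\sigma)}\big)_{k\ge 1}$ be a sequence of real numbers. Then there exists a rearrangement $\big( b(j_1,\dots,j_n)\;\big|\; j_1,\dots,j_n\ge 1\big)$ of $(a_m)_m$ such that for each $\sigma\in \mathrm{Sym}(n)$ and each $k\ge 1$ one has $$\sum_{j_1=1}^{k}\sum_{j_2=1}^{\infty}\dots\sum_{j_n=1}^{\infty} b(j_{\sigma(1)},\dots,j_{\sigma(n)})=s_k^{(\sigma)}.$$
   Context: $\mathbb{N}=\{1,2,3,\dots\}$, and $\mathrm{Sym}(n)$ is the group of all permutations of $\{1,\dots,n\}$. A series of real numbers is conditionally convergent if it converges but does not converge absolutely. Rearrangement: a rearrangement $\big( b(j_1,\dots,j_n)\;\big|\; j_1,\dots,j_n\ge 1\big)$ of a sequence $(a_m)_{m\in\mathbb{N}}$ is a mapping $b:\mathbb{N}^n\to\mathbb{R}$ for which there is a bijection $\tau:\mathbb{N}^n\to\mathbb{N}$ with $b(j_1,\dots,j_n)=a_{\tau(j_1,\dots,j_n)}$ for all $(j_1,\dots,j_n)\in\mathbb{N}^n$. Multiple sums are iterated sums, evaluated from the innermost (over $j_n$) to the outermost (over $j_1$); each infinite sum is the limit of its partial sums in the natural order of the index, and an equality for such a sum includes the assertion that all the infinite sums involved converge. *)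

(* Defs.v *)
From HB Require Import structures.
From mathcomp Require Import all_boot all_order all_algebra all_fingroup.
From mathcomp Require Import all_classical all_reals all_analysis.

Set Implicit Arguments.
Unset Strict Implicit.
Unset Printing Implicit Defensive.

Import Order.TTheory GRing.Theory Num.Theory.
Import numFieldNormedType.Exports.

Local Open Scope classical_set_scope.
Local Open Scope ring_scope.

(* The positive integers are encoded by nat, with m : nat standing for m + 1:
   terms of sequences and coordinates of multi-indices are numbered from 0. *)

Definition conditionally_convergent (R : realType) (a : nat -> R) : Prop :=
  cvgn (series a) /\ ~ cvgn [normed series a].

Definition is_rearrangement (R : realType) (n : nat) (a : nat -> R)
    (b : n.-tuple nat -> R) : Prop :=
  exists tau : n.-tuple nat -> nat,
    bijective tau /\ forall j : n.-tuple nat, b j = a (tau j).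

(* is_iterated_sum f l: all the infinite sums in
   sum_{j_1} (sum_{j_2} ... (sum_{j_n} f (j_1, ..., j_n))) converge, and the
   value is l.  In the recursive step g j is the value of the sum over
   j_2, ..., j_n for j_1 = j. *)
Fixpoint is_iterated_sum (R : realType) (n : nat) :
    (n.-tuple nat -> R) -> R -> Prop :=
  match n return (n.-tuple nat -> R) -> R -> Prop with
  | 0 => fun f l => f [tuple] = l
  | m.+1 => fun f l => exists g : nat -> R,
      (forall j : nat,
        is_iterated_sum (fun t : m.-tuple nat => f [tuple of j :: t]) (g j)) /\
      series g @ \oo --> l
  end.

(* The same with the outermost index j_1 restricted to its first k values; the
   inner sums are only required to converge for those.  There is no outermost
   index when n = 0, and the relation is then empty. *)
Definition is_iterated_psum (R : realType) (n k : nat) :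
    (n.-tuple nat -> R) -> R -> Prop :=
  match n return (n.-tuple nat -> R) -> R -> Prop with
  | 0 => fun _ _ => False
  | m.+1 => fun f l => exists g : nat -> R,
      (forall j : nat, (j < k)%N ->
        is_iterated_sum (fun t : m.-tuple nat => f [tuple of j :: t]) (g j)) /\
      \sum_(0 <= j < k) g j = l
  end.

(* Main.v *)
(* Any family of sums over the axis-parallel lines of N^n can be realised by a
   rearrangement of (a_m).  A point belongs to the line along its largest
   coordinate (ties broken by the index of the coordinate), so that a line owns
   all but finitely many of its points, and its other points are owned by lines
   of smaller level.  The indices m are distributed among the lines so that the
   positive and the negative terms allotted to each line both have infinite sum;
   by recursion on the level, each line fills the points it owns by Riemann's
   greedy procedure, its target being corrected by the finitely many terms it
   does not own.

   The theorem follows by induction on n: for each direction d, the case n - 1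
   (for n = 1, without the requirement to be a rearrangement) gives line sums in
   direction d having the prescribed iterated sums for the permutations whose
   innermost summation runs in direction d. *)
Require Import Defs.
From HB Require Import structures.
From mathcomp Require Import all_boot all_order all_algebra all_fingroup.
From mathcomp Require Import all_classical all_reals all_analysis.
From mathcomp Require Import zify ring lra.

Set Implicit Arguments.
Unset Strict Implicit.
Unset Printing Implicit Defensive.

Import Order.TTheory GRing.Theory Num.Theory.
Import numFieldNormedType.Exports.

Local Open Scope classical_set_scope.
Local Open Scope ring_scope.

(** * Recursion along a measure *)

(** Iterating [F] more than [mu x] times from the constant [v0] stabilises the value at [x], so the
    solution is read off at iterate [(mu x).+1]. *)
Lemma measure_recursion (T V : Type) (mu : T -> nat) (F : (T -> V) -> T -> V)
    (v0 : V) :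
  (forall f g x, (forall y, (mu y < mu x)%N -> f y = g y) -> F f x = F g x) ->
  exists f, forall x, f x = F f x.
Proof.
move=> Fext; pose it k := iter k F (fun=> v0).
have itE k k' x : (mu x < k)%N -> (mu x < k')%N -> it k x = it k' x.
  elim: k k' x => // k IH [|k'] x //= xk xk'.
  by apply: Fext => y yx; apply: IH; lia.
exists (fun x => it (mu x).+1 x) => x.
by rewrite [LHS]/=; apply: Fext => y yx; apply: itE; lia.
Qed.

(** * Axis-parallel lines and the points they own *)

Section Points.
Variable n : nat.
Implicit Types (p : n.+1.-tuple nat) (x : n.-tuple nat) (d : 'I_n.+1).

Definition insert d x (t : nat) : n.+1.-tuple nat :=
  [tuple if unlift d i is Some j then tnth x j else t | i < n.+1].

Definition erase d p : n.-tuple nat := [tuple tnth p (lift d j) | j < n].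

Lemma insertK d p : insert d (erase d p) (tnth p d) = p.
Proof.
apply: eq_from_tnth => i; rewrite tnth_mktuple.
by case: unliftP => [j|] ->; rewrite ?tnth_mktuple.
Qed.

Lemma tnth_insert d x t : tnth (insert d x t) d = t.
Proof. by rewrite tnth_mktuple unlift_none. Qed.

Lemma tnth_insert_lift d x t j : tnth (insert d x t) (lift d j) = tnth x j.
Proof. by rewrite tnth_mktuple liftK. Qed.

Lemma erase_insert d x t : erase d (insert d x t) = x.
Proof. by apply: eq_from_tnth => i; rewrite tnth_mktuple tnth_insert_lift. Qed.

(** Lexicographic order on pairs (coordinate, index), coded in one number so that ties are
    broken. *)
Definition weight p (i : 'I_n.+1) : nat := (tnth p i * n.+1 + i)%N.

Lemma weight_inj p : injective (weight p).
Proof.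
move=> i j /(congr1 (modn^~ n.+1)).
by rewrite !modnMDl !modn_small // => /val_inj.
Qed.

Definition owner p : 'I_n.+1 := [arg max_(i > ord0) weight p i].

Lemma weight_owner p i : (weight p i <= weight p (owner p))%N.
Proof. by rewrite /owner; case: arg_maxnP => // j _; exact. Qed.

(** The least strict upper bound of the weights of the fixed coordinates of the line. *)
Definition level (l : 'I_n.+1 * n.-tuple nat) : nat :=
  \max_(j < n) (tnth l.2 j * n.+1 + lift l.1 j).+1.

Lemma level_leP d x t m :
  reflect (forall j, weight (insert d x t) (lift d j) < m)%N (level (d, x) <= m)%N.
Proof.
apply: (iffP (bigmax_leqP _ _ _)) => [H j|H j _].
  by rewrite /weight tnth_insert_lift; exact: H.
by move: (H j); rewrite /weight tnth_insert_lift.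
Qed.

(** The quotient of [level l - l.1] by [n.+1], rounded up: the first position on the line that the
    line owns. *)
Definition threshold (l : 'I_n.+1 * n.-tuple nat) : nat :=
  ((level l - l.1 + n) %/ n.+1)%N.

Lemma threshold_le d x t :
  (threshold (d, x) <= t)%N = (level (d, x) <= weight (insert d x t) d)%N.
Proof.
rewrite /weight tnth_insert -ltnS /threshold ltn_divLR //=; lia.
Qed.

Lemma ownerP d x t : reflect (owner (insert d x t) = d) (threshold (d, x) <= t)%N.
Proof.
rewrite threshold_le; apply: (iffP (level_leP d x t _)) => [H|E j].
  case: (unliftP d (owner (insert d x t))) => // j E.
  by have := weight_owner (insert d x t) d; rewrite leqNgt E H.
have := weight_owner (insert d x t) (lift d j); rewrite E ltn_neqAle => ->.
by rewrite andbT; apply/eqP => /weight_inj /eqP; rewrite eq_sym (negPf (neq_lift _ _)).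
Qed.

Definition line p := (owner p, erase (owner p) p).

Lemma threshold_owner p : (threshold (line p) <= tnth p (owner p))%N.
Proof. by apply/ownerP; rewrite insertK. Qed.

(** Such a point is owned in another direction. The weight of its owning coordinate is below the
    level of the present line and bounds that of the owning line. This descent justifies recursion
    on the level. *)
Lemma level_line d x t :
  (t < threshold (d, x))%N -> (level (line (insert d x t)) < level (d, x))%N.
Proof.
move=> tl; set p := insert d x t.
have le_own : (level (line p) <= weight p (owner p))%N.
  by have := threshold_owner p; rewrite threshold_le insertK.
apply: leq_ltn_trans le_own _.
case: (unliftP d (owner p)) => [j ->|E].
  by move/level_leP: (leqnn (level (d, x))); exact.
by move: tl; rewrite ltnNge; case/negP; apply/ownerP.
Qed.

Lemma line_insert d x t : (threshold (d, x) <= t)%N -> line (insert d x t) = (d, x).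
Proof. by move/ownerP; rewrite /line => ->; rewrite erase_insert. Qed.

End Points.

(** * Riemann's greedy procedure *)

(** Without a switch, the value [s] would persist once taken. This will locate a moment when the
    partial sums cross their target. *)
Lemma exists_switch (e : nat -> bool) :
  (forall s t0, exists2 t, (t0 <= t)%N & e t = s) ->
  forall s t0, exists2 t, (t0 <= t)%N & e t = s /\ e t.+1 = ~~ s.
Proof.
move=> He s t0; have [t1 t01 et1] := He s t0; have [t2 t12 et2] := He (~~ s) t1.
apply: contrapT => H; suff : e t2 = s by rewrite et2; case: (s).
rewrite -(subnKC t12); elim: (t2 - t1)%N => [|k IH]; first by rewrite addn0.
rewrite addnS; case: (e (t1 + k).+1 =P s) => // /eqP ns.
case: H; exists (t1 + k)%N; first lia.
by split=> //; move: ns; case: (e _) (s) => -[].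
Qed.

Section Riemann.
Variables (R : realType) (w : bool -> nat -> R) (L : R).
Hypothesis w_ge0 : forall s i, 0 <= w s i.
Hypothesis w_cvg0 : forall s, w s @ \oo --> 0.
Hypothesis w_div : forall s (B : R), exists k, B <= \sum_(i < k) w s i.

(* Of the first t terms, [greedy t true] are taken from - w true (negative) and
   [greedy t false] from w false; S is the partial sum they give. *)
Let S (c : bool -> nat) : R := \sum_(i < c false) w false i - \sum_(i < c true) w true i.
Let neg_next (c : bool -> nat) : bool := L < S c.
Fixpoint greedy (t : nat) : bool -> nat :=
  if t is t'.+1 then fun s => ((s == neg_next (greedy t')) + greedy t' s)%N
  else fun=> 0%N.
Definition greedy_sign (t : nat) : bool := neg_next (greedy t).
Definition greedy_term (t : nat) : bool * nat :=
  (greedy_sign t, greedy t (greedy_sign t)).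

Lemma greedyS t s : greedy t.+1 s = ((s == greedy_sign t) + greedy t s)%N.
Proof. by []. Qed.

Lemma greedy_total t : (greedy t false + greedy t true = t)%N.
Proof. by elim: t => // t IH; rewrite !greedyS; case: (greedy_sign t) => /=; lia. Qed.

Lemma greedy_mono s t t' : (t <= t')%N -> (greedy t s <= greedy t' s)%N.
Proof.
move=> tt'; rewrite -(subnKC tt'); elim: (t' - t)%N => [|k IH]; first by rewrite addn0.
by rewrite addnS greedyS; lia.
Qed.

(** If [s] were never chosen again, all later terms would come from the other family, whose
    divergence carries the partial sum across [L], where the rule selects [s]. *)
Lemma greedy_sign_inf s t0 : exists2 t, (t0 <= t)%N & greedy_sign t = s.
Proof.
apply: contrapT => H.
have sg k : greedy_sign (t0 + k) = ~~ s.
  case: (greedy_sign (t0 + k) =P s) => [E|/eqP]; last by case: (greedy_sign _) (s) => -[].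
  by case: H; exists (t0 + k)%N => //; lia.
have stop k : greedy (t0 + k) s = greedy t0 s.
  by elim: k => [|k IH]; rewrite ?addn0 // addnS greedyS sg IH; case: (s).
have grow k : greedy (t0 + k) (~~ s) = (greedy t0 (~~ s) + k)%N.
  have := greedy_total (t0 + k); have := greedy_total t0; have := stop k.
  by case: (s) => /=; lia.
(* This bound outweighs [L] together with the terms of sign [s], whose number is frozen since
   [t0]. *)
have [k Hk] := w_div (~~ s) (`|\sum_(i < greedy t0 s) w s i| + `|L| + 1).
have W : `|\sum_(i < greedy t0 s) w s i| + `|L| + 1 <=
    \sum_(i < greedy (t0 + k) (~~ s)) w (~~ s) i.
  apply: le_trans Hk _; rewrite grow addnC big_split_ord /= lerDl.
  by apply: sumr_ge0.
have := sg k; rewrite /greedy_sign /neg_next /S; move: (stop k) W.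
have := ler_norm L; have := ler_norm (- L); rewrite normrN.
case: (s) => /= ? ? -> W' sgk.
- move/negbT: sgk; rewrite -leNgt => sgk.
  have := ler_norm (\sum_(i < greedy t0 true) w true i); lra.
- have := ler_norm (\sum_(i < greedy t0 false) w false i); lra.
Qed.

Lemma greedy_unbounded s m : exists t, (m <= greedy t s)%N.
Proof.
elim: m => [|m [t mt]]; first by exists 0%N.
have [t' tt' E] := greedy_sign_inf s t; exists t'.+1.
by rewrite greedyS E eqxx ltnS (leq_trans mt) // greedy_mono.
Qed.

Lemma greedy_term_inj : injective greedy_term.
Proof.
have lt t t' : (t < t')%N -> greedy_term t <> greedy_term t'.
  move=> tt' [E]; rewrite -E => /eqP.
  have := greedy_mono (greedy_sign t) tt'; rewrite greedyS eqxx; lia.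
move=> t t' E; case: (ltngtP t t') => // H; first by case: (lt _ _ H).
by case: (lt _ _ H).
Qed.

Lemma greedy_term_surj q : exists t, greedy_term t = q.
Proof.
case: q => s m.
have ex : exists t, (m < greedy t s)%N by exact: greedy_unbounded.
(* The step that first brings the count of sign [s] above [m] takes term [m]. *)
case: (ex_minnP ex) => -[//|t] mt tmin; exists t.
have tm : ~~ (m < greedy t s)%N by apply/negP => /tmin; rewrite ltnn.
move: mt; rewrite greedyS /greedy_term.
by case: eqP => [<-|]; [move=> ?; congr pair; lia | lia].
Qed.

Lemma greedy_term_bij : bijective greedy_term.
Proof.
have [g gK] := choice greedy_term_surj.
by exists g => // t; apply: greedy_term_inj; rewrite gK.
Qed.

Let term t : R := (-1) ^+ greedy_sign t * w (greedy_sign t) (greedy t (greedy_sign t)).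

Lemma series_greedy t : series term t = S (greedy t).
Proof.
elim: t => [|t IH]; first by rewrite /series /= big_geq // /S /= !big_ord0 subr0.
rewrite seriesSr IH /S /term !greedyS.
by case: (greedy_sign t); rewrite /= !add1n !add0n big_ord_recr /= ?expr0 ?expr1; ring.
Qed.

(** Once the next terms are at most [e], a partial sum within [e] of [L] stays so, since each step
    heads towards [L]. A change of sign provides the first such partial sum. *)
Lemma series_greedy_cvg : series term @ \oo --> L.
Proof.
apply/cvgrPdist_le => /= e e0.
have small s : exists N, forall i, (N <= i)%N -> w s i <= e.
  have /cvgrPdist_le/(_ e e0) [N _ HN] := @w_cvg0 s.
  exists N => i /HN /=; rewrite sub0r normrN; exact: le_trans (ler_norm _).
have {small} [N HN] : exists N, forall s i, (N <= i)%N -> w s i <= e.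
  have [N1 H1] := small true; have [N2 H2] := small false.
  exists (maxn N1 N2) => -[] i; rewrite geq_max => /andP[? ?]; [exact: H1|exact: H2].
have {HN} [t0 Ht0] : exists t0, forall t, (t0 <= t)%N ->
    0 <= w (greedy_sign t) (greedy t (greedy_sign t)) <= e.
  have [t1 H1] := greedy_unbounded true N; have [t2 H2] := greedy_unbounded false N.
  exists (maxn t1 t2) => t; rewrite geq_max => /andP[? ?]; rewrite w_ge0 HN //.
  case: (greedy_sign t); [apply: leq_trans H1 _|apply: leq_trans H2 _]; exact: greedy_mono.
have step t : (t0 <= t)%N -> `|L - series term t| <= e -> `|L - series term t.+1| <= e.
  move=> /Ht0; rewrite [series _ t.+1]seriesSr /term.
  have : greedy_sign t = (L < series term t) by rewrite series_greedy.
  case: (greedy_sign t) => /esym; rewrite ?expr0 ?expr1 !ler_norml.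
    by move=> ?; lra.
  by move=> /negbT; rewrite -leNgt; lra.
(* At this switch the partial sum passes from at most [L] to above [L] by a term of size at most
   [e]. *)
have [t1 t01 [sg0 sg1]] := exists_switch greedy_sign_inf false t0.
exists t1.+1 => // t /= t1t; rewrite -(subnKC t1t).
elim: (t - t1.+1)%N => [|k IH]; last by rewrite addnS; apply: step => //; lia.
have sgE u : greedy_sign u = (L < series term u) by rewrite series_greedy.
rewrite addn0; move: sg1 (sg0) (Ht0 _ t01).
rewrite [in X in X -> _]sgE [in X in _ -> X -> _]sgE [series _ t1.+1]seriesSr.
rewrite /term sg0 expr0 => ? /negbT; rewrite -leNgt ler_norml; lra.
Qed.

End Riemann.

(** * Enumeration of colour classes *)

Section Enumeration.
Variables (K : eqType) (color : nat -> K).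
Hypothesis color_inf : forall k N, exists2 m, (N <= m)%N & color m = k.

Definition rank (k : K) (m : nat) : nat := \sum_(i < m) (color i == k).

Lemma rankS k m : rank k m.+1 = (rank k m + (color m == k))%N.
Proof. by rewrite /rank big_ord_recr. Qed.

Lemma rank_mono k m m' : (m <= m')%N -> (rank k m <= rank k m')%N.
Proof.
move=> mm'; rewrite -(subnKC mm'); elim: (m' - m)%N => [|i IH]; first by rewrite addn0.
by rewrite addnS rankS; lia.
Qed.

Lemma rank_inj k m m' : color m = k -> color m' = k -> rank k m = rank k m' -> m = m'.
Proof.
have lt m1 m2 : color m1 = k -> (m1 < m2)%N -> (rank k m1 < rank k m2)%N.
  by move=> E /(rank_mono k); rewrite rankS E eqxx addn1.
move=> E E' r; case: (ltngtP m m') => // /lt H; [have := H E|have := H E']; lia.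
Qed.

Lemma rank_surj k i : exists m, color m = k /\ rank k m = i.
Proof.
have ex : exists m, (i < rank k m)%N.
  elim: i => [|i [m im]].
    by have [m _ E] := color_inf k 0; exists m.+1; rewrite rankS E eqxx; lia.
  have [m' mm' E] := color_inf k m; exists m'.+1.
  by rewrite rankS E eqxx; have := rank_mono k mm'; lia.
case: (ex_minnP ex) => -[|m]; first by rewrite /rank big_ord0.
move=> im mmin; exists m.
have : ~~ (i < rank k m)%N by apply/negP => /mmin; rewrite ltnn.
by move: im; rewrite rankS; case: eqP => [|_] ? ?; [split=> //; lia|lia].
Qed.

(** [idx] inverts the map from [m] to its colour and rank. It lists each class increasingly, so the
    sum of a class below [N] is an initial sum of its list; divergence carries over this way. *)
Lemma enumerate_colors : exists idx : K * nat -> nat,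
  [/\ bijective idx, forall q, color (idx q) = q.1 &
    forall (V : nmodType) (F : nat -> V) k N,
      \sum_(0 <= m < N | color m == k) F m = \sum_(i < rank k N) F (idx (k, i : nat))].
Proof.
have [idx idxP] := choice (fun q : K * nat => rank_surj q.1 q.2).
have idxK m : idx (color m, rank (color m) m) = m.
  by have [E r] := idxP (color m, rank (color m) m); exact: (rank_inj E).
exists idx; split=> [|q|V F k N].
- exists (fun m => (color m, rank (color m) m)) => // -[k i].
  by have [/= E r] := idxP (k, i); rewrite E r.
- by have [] := idxP q.
elim: N => [|N IH]; first by rewrite big_geq // /rank !big_ord0.
rewrite big_mkcond big_nat_recr //= -big_mkcond IH rankS.
case: eqP => [E|_]; last by rewrite addn0 addr0.
by rewrite addn1 big_ord_recr /= -E idxK.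
Qed.

End Enumeration.

(** * Colourings with divergent classes *)

(** Decode [i] as a pair (colour, number): each colour lies in infinitely many pairs. [c0] is the
    value where [i] codes no pair. *)
Lemma recurrent_sequence (C : countType) (c0 : C) :
  exists h : nat -> C, forall c N, exists2 i, (N <= i)%N & h i = c.
Proof.
exists (fun i => odflt c0 (omap fst (unpickle i : option (C * nat)))) => c N.
have inj : injective (fun k : nat => pickle (c, k)).
  by move=> k k' E; have [] := pcan_inj (@pickleK _) E.
apply: contrapT => H.
(* Pigeonhole: [N.+1] distinct codes would lie below [N]. *)
have lt (k : 'I_N.+1) : (pickle (c, val k) < N)%N.
  rewrite ltnNge; apply/negP => le; apply: H.
  by exists (pickle (c, val k)) => //; rewrite pickleK.
have : injective (fun k : 'I_N.+1 => Ordinal (lt k)) by move=> k k' [/inj/val_inj].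
by move/leq_card; rewrite !card_ord ltnn.
Qed.

Section Coloring.
Variables (R : realType) (w : bool -> nat -> R).
Hypothesis w_ge0 : forall s i, 0 <= w s i.
Hypothesis w_div : forall s N (B : R), exists M, B <= \sum_(N <= m < M) w s m.

Lemma sum_nat_mono (u : nat -> R) N M M' : (forall i, 0 <= u i) ->
  (M <= M')%N -> \sum_(N <= m < M) u m <= \sum_(N <= m < M') u m.
Proof.
move=> u0 MM'; case: (leqP N M) => [NM|MN].
  by rewrite (big_cat_nat NM MM') /= lerDl sumr_ge0.
by rewrite big_geq ?sumr_ge0 // ltnW.
Qed.

Lemma divergent_coloring (C : countType) (c0 : C) :
  exists color : nat -> C, forall c s (B : R), exists M,
    B <= \sum_(0 <= m < M | color m == c) w s m.
Proof.
(* Cut nat into consecutive blocks on which both sums are at least 1; a whole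
   block gets the same colour, and every colour recurs. *)
have [h h_inf] := recurrent_sequence c0.
have /choice [nxt nxtP] : forall N, exists M,
    (N < M)%N /\ forall s, 1 <= \sum_(N <= m < M) w s m.
  move=> N.
  have [M1 H1] := w_div true N 1; have [M2 H2] := w_div false N 1.
  exists (maxn N.+1 (maxn M1 M2)); split=> [|s]; first by rewrite leq_max leqnn.
  case: s; [apply: le_trans H1 _|apply: le_trans H2 _]; apply: sum_nat_mono => //; lia.
pose bd i := iter i nxt 0%N.
have bd_mono i j : (i <= j)%N -> (bd i <= bd j)%N.
  move=> ij; rewrite -(subnKC ij); elim: (j - i)%N => [|k]; first by rewrite addn0.
  rewrite addnS /bd /= -/(bd _) => /leq_trans; apply; apply: ltnW.
  by case: (nxtP (bd (i + k)%N)).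
have bd_ge i : (i <= bd i)%N.
  by elim: i => // i IH; apply: leq_ltn_trans IH _; case: (nxtP (bd i)).
have /choice [blk blkP] : forall m, exists i, (bd i <= m < bd i.+1)%N.
  move=> m.
  have ex : exists i, (m < bd i)%N by exists m.+1; exact: bd_ge.
  case: (ex_minnP ex) => -[//|i] mi imin; exists i; rewrite mi andbT leqNgt.
  by apply/negP => /imin; rewrite ltnn.
have blkE i m : (bd i <= m < bd i.+1)%N -> blk m = i.
  move=> /andP[im mi]; have /andP[bm mb] := blkP m.
  case: (ltngtP (blk m) i) => // /bd_mono; lia.
exists (fun m => h (blk m)) => c s B.
(* Each further block of colour [c] adds at least 1. *)
have grow k : exists M, k%:R <= \sum_(0 <= m < M | h (blk m) == c) w s m.
  elim: k => [|k [M HM]]; first by exists 0%N; rewrite big_geq.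
  have [i Mi hi] := h_inf c M; exists (bd i.+1).
  have Mb : (M <= bd i)%N by exact: leq_trans Mi (bd_ge i).
  have bS := bd_mono _ _ (leqnSn i).
  rewrite (big_cat_nat (leq0n M) (leq_trans Mb bS)) -natr1 lerD //.
  rewrite (big_cat_nat Mb bS) /=.
  rewrite ler_wpDl ?sumr_ge0 //.
  have [_ /(_ s) /le_trans] := nxtP (bd i); apply.
  rewrite le_eqVlt; apply/orP; left; apply/eqP.
  rewrite [RHS]big_nat_cond [LHS]big_nat_cond; apply: eq_bigl => m; rewrite andbT.
  by case: (boolP (_ <= _ < _)%N) => //= /blkE ->; rewrite hi eqxx.
have [M HM] := grow (Num.truncn `|B|).+1; exists M; apply: le_trans HM.
by apply/ltW; apply: le_lt_trans (ler_norm _) (truncnS_gt _).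
Qed.
End Coloring.

(** * Splitting a conditionally convergent series *)

Section ConditionallyConvergent.
Variables (R : realType) (a : nat -> R).
Hypothesis ha : conditionally_convergent a.

Definition signed_part (s : bool) (m : nat) : R :=
  if (a m < 0) == s then `|a m| else 0.

Lemma signed_part_ge0 s m : 0 <= signed_part s m.
Proof. by rewrite /signed_part; case: ifP. Qed.

(** A bounded part would converge, and with the convergence of the series it would give absolute
    convergence. *)
Lemma signed_part_div s N (B : R) : exists M, B <= \sum_(N <= m < M) signed_part s m.
Proof.
apply: contrapT => H; case: ha => cvg_a; apply.
have cvg_s : cvgn (series (signed_part s)).
  apply: nondecreasing_is_cvgn.
    by apply/nondecreasing_seqP => m; rewrite seriesSr lerDl signed_part_ge0.
  exists (series (signed_part s) N + `|B|) => _ [M _ <-].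
  have [MN|/ltnW NM] := leqP M N.
    rewrite ler_wpDr // -subr_ge0 sub_series_geq // sumr_ge0 // => i _.
    exact: signed_part_ge0.
  rewrite -lerBlDl sub_series_geq // ltW // (lt_le_trans _ (ler_norm _)) //.
  by rewrite ltNge; apply/negP => BM; apply: H; exists M.
(* Termwise, [|a|] is twice the negative part plus [a], and twice the positive part minus [a]. *)
have E : [normed series a] = series (signed_part s) + series (signed_part s)
    + (-1) ^+ (~~ s) *: series a.
  apply/funext => k; rewrite /series /= !fctE scaler_sumr -!big_split /=.
  apply: eq_bigr => m _; rewrite /signed_part.
  case: ltrgt0P; case: (s); rewrite /= ?expr0 ?expr1 ?scale1r ?scaleN1r; lra.
rewrite E; apply: is_cvgD; first exact: is_cvgD.
exact: is_cvgZr.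
Qed.

(** The indices allotted to [l] do not depend on the target [r]; only their order does. Hence the
    targets [Lambda] can be chosen later, even in terms of [phi], without losing bijectivity. *)
Lemma indexed_rearrangements (C : countType) (c0 : C) :
  exists phi : C -> R -> nat -> nat,
    (forall l r, series (a \o phi l r) @ \oo --> r) /\
    forall Lambda : C -> R, bijective (fun q => phi q.1 (Lambda q.1) q.2).
Proof.
have [c c_div] := divergent_coloring signed_part_ge0 signed_part_div c0.
pose color m := (c m, a m < 0).
have partE l s N : \sum_(0 <= m < N | c m == l) signed_part s m =
    \sum_(0 <= m < N | color m == (l, s)) `|a m|.
  rewrite [RHS]big_mkcond [LHS]big_mkcond; apply: eq_bigr => m _.
  by rewrite /signed_part /color xpair_eqE; case: (c m == l).
(* The sum over a finite class could not grow past its last index. *)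
have color_inf k N : exists2 m, (N <= m)%N & color m = k.
  case: k => l s; apply: contrapT => H.
  have [M] := c_div l s (\sum_(0 <= m < N | c m == l) signed_part s m + 1).
  apply/negP; rewrite -ltNge; have [MN|/ltnW NM] := leqP M N.
    rewrite (big_cat_nat (leq0n M) MN) /= -addrA ltrDl.
    by rewrite ltr_wpDl // sumr_ge0 // => i _; exact: signed_part_ge0.
  rewrite !partE (big_cat_nat (leq0n N) NM) /= ltrD2l.
  rewrite big_nat_cond big1 // => m /andP[/andP[Nm _] /eqP E].
  by case: H; exists m.
have [idx [[g idxK gK] idx_color idx_sum]] := enumerate_colors color_inf.
pose w (l : C) (s : bool) (i : nat) : R := `|a (idx ((l, s), i))|.
have w_ge0 l s i : 0 <= w l s i by exact: normr_ge0.
have w_cvg0 l s : w l s @ \oo --> 0.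
  have /cvgrPdist_le a0 := cvg_series_cvg_0 ha.1.
  apply/cvgrPdist_le => e /a0 [N _ HN].
  (* Beyond this position in any class, [idx] avoids all indices below [N]. *)
  exists (\max_(m < N) (g m).2).+1 => // i /= Bi.
  have := HN (idx ((l, s), i)); rewrite /= !sub0r !normrN normr_id; apply.
  rewrite leqNgt; apply/negP => iN; move: Bi; rewrite ltnNge.
  have := @leq_bigmax _ (fun m : 'I_N => (g m).2) (Ordinal iN).
  by rewrite /= idxK => ->.
have w_div l s (B : R) : exists k, B <= \sum_(i < k) w l s i.
  have [M HM] := c_div l s B; exists (rank color (l, s) M).
  by rewrite -(idx_sum _ (fun m => `|a m|)) -partE.
have a_idx l s i : a (idx ((l, s), i)) = (-1) ^+ s * w l s i.
  have /= := idx_color ((l, s), i); rewrite /color /w => -[_].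
  case: s => as_; first by rewrite expr1 mulN1r ltr0_norm ?opprK.
  by rewrite expr0 mul1r ger0_norm // leNgt as_.
pose gt l r := greedy_term (w l) r.
exists (fun l r t => idx ((l, (gt l r t).1), (gt l r t).2)); split=> [l r|Lambda].
  rewrite (_ : a \o _ = fun t => (-1) ^+ greedy_sign (w l) r t *
      w l (greedy_sign (w l) r t) (greedy (w l) r t (greedy_sign (w l) r t))).
    exact: series_greedy_cvg (w_ge0 l) (w_cvg0 l) (w_div l).
  by apply/funext => t; exact: a_idx.
have bij l : bijective (gt l (Lambda l)).
  exact: greedy_term_bij (w_ge0 l) (w_div l).
have /choice [inv invP] : forall l, exists f,
    cancel (gt l (Lambda l)) f /\ cancel f (gt l (Lambda l)).
  by move=> l; have [f ? ?] := bij l; exists f.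
exists (fun m => ((g m).1.1, inv (g m).1.1 ((g m).1.2, (g m).2))).
- by move=> [l t]; rewrite idxK; congr pair; exact: (invP l).1.
- move=> m; rewrite -[RHS]gK; case: (g m) => -[l s] i.
  by congr (idx (l, _, _)); rewrite /fst /snd (invP l).2.
Qed.

(** * Prescribing all line sums *)

Lemma rearrangement_with_line_sums (n : nat) (L : 'I_n.+1 -> n.-tuple nat -> R) :
  exists b : n.+1.-tuple nat -> R, is_rearrangement a b /\
    forall d x, series (fun t => b (insert d x t)) @ \oo --> L d x.
Proof.
have [phi [phi_cvg phi_bij]] :=
  indexed_rearrangements (ord0 : 'I_n.+1, [tuple of nseq n 0%N]).
pose pos (p : n.+1.-tuple nat) :=
  (line p, tnth p (owner p) - threshold (line p))%N.
pose tau Lambda p := phi (pos p).1 (Lambda (pos p).1) (pos p).2.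
pose F Lambda l := L l.1 l.2 - 
  \sum_(0 <= t < threshold l) a (tau Lambda (insert l.1 l.2 t)).
(* The equation for the target of a line refers to [Lambda] only at lines of smaller level. *)
have [Lambda LambdaE] : exists Lambda, forall l, Lambda l = F Lambda l.
  apply: (@measure_recursion _ _ (@level n) F 0) => f g [d x] fg.
  congr (_ - _); apply: eq_big_nat => t /andP[_ tl].
  by rewrite /tau fg //; exact: level_line.
have pos_bij : bijective pos.
  exists (fun q => insert q.1.1 q.1.2 (threshold q.1 + q.2)) => [p|[[d x] t]].
    by rewrite /= subnKC ?threshold_owner // insertK.
  have ti := leq_addr t (threshold (d, x)).
  rewrite /pos line_insert //; move/ownerP: ti => ->.
  by rewrite tnth_insert addKn.
exists (a \o tau Lambda); split.
  by exists (tau Lambda); split=> //; exact: bij_comp (phi_bij Lambda) pos_bij.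
(* From the threshold on, the line runs through its own greedy sequence in order. *)
move=> d x; rewrite -(cvg_shiftn (threshold (d, x))).
set u := series _.
have -> : (fun k => u (k + threshold (d, x))%N) =
    (fun k => u (threshold (d, x)) + series (a \o phi (d, x) (Lambda (d, x))) k).
  apply/funext => k; rewrite /u series_addn; congr (_ + _).
  rewrite -{1}(add0n (threshold _)) big_addn addnK /series /=.
  apply: eq_bigr => t _; rewrite /tau /pos addnC.
  have ti := leq_addr t (threshold (d, x)).
  rewrite line_insert //; move/ownerP: ti => ->.
  by rewrite tnth_insert addKn.
rewrite -(subrKC (u (threshold (d, x))) (L d x)); apply: cvgD; first exact: cvg_cst.
have <- : Lambda (d, x) = L d x - u (threshold (d, x)) by exact: LambdaE.
exact: phi_cvg.
Qed.

End ConditionallyConvergent.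

(** * Iterated sums under permutation of coordinates *)

(** Collapses the innermost sum, whereas the definition peels off the outermost index; hence the
    induction over the outer indices. *)
Lemma is_iterated_sum_rcons (R : realType) n (f : n.+1.-tuple nat -> R)
    (g : n.-tuple nat -> R) l :
  (forall t : n.-tuple nat, series (fun u => f [tuple of rcons t u]) @ \oo --> g t) ->
  is_iterated_sum g l -> is_iterated_sum f l.
Proof.
elim: n f g l => [|n IH] f g l fg /=.
  move=> <-; exists (fun u => f [tuple u]); split=> [j|].
    by congr f; exact: val_inj.
  rewrite (_ : (fun u => f [tuple u]) = fun u => f [tuple of rcons [tuple] u]).
    exact: fg.
  by apply/funext => u; congr f; exact: val_inj.
move=> [h [gh hl]]; exists h; split=> // j.
apply: (IH (fun t : n.+1.-tuple nat => f [tuple of j :: t])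
  (fun t : n.-tuple nat => g [tuple of j :: t])) (gh j) => t.
rewrite (_ : (fun u => _) = fun u => f [tuple of rcons [tuple of j :: t] u]).
  exact: fg.
by apply/funext => u; congr f; exact: val_inj.
Qed.

Lemma lift_perm_surj n (i j : 'I_n.+1) (s : {perm 'I_n.+1}) :
  s i = j -> exists s', s = lift_perm i j s'.
Proof.
move=> sij; have lift_s k : exists k', s (lift i k) = lift j k'.
  case: (unliftP j (s (lift i k))) => [k' ->|]; first by exists k'.
  by rewrite -sij => /perm_inj /eqP; rewrite eq_sym (negPf (neq_lift _ _)).
have [f fP] := choice lift_s.
have f_inj : injective f.
  by move=> k k' E; apply: (@lift_inj _ i); apply: (@perm_inj _ s); rewrite !fP E.
exists (perm f_inj); apply/permP => k.
case: (unliftP i k) => [k'|] ->; last by rewrite lift_perm_id.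
by rewrite lift_perm_lift permE fP.
Qed.

(** The innermost variable lands in coordinate [d], so the innermost sum runs along a line in
    direction [d]. *)
Lemma tuple_perm_rcons n (s : {perm 'I_n.+1}) (d : 'I_n.+2) (t : n.+1.-tuple nat) u :
  [tuple tnth [tuple of rcons t u] (lift_perm d ord_max s i) | i < n.+2] =
  insert d [tuple tnth t (s i) | i < n.+1] u.
Proof.
apply: eq_from_tnth => i; rewrite !tnth_mktuple.
case: unliftP => [j|] ->.
  rewrite lift_perm_lift tnth_mktuple !(tnth_nth 0%N) [tval _]/= nth_rcons.
  by rewrite size_tuple lift_max ltn_ord.
by rewrite lift_perm_id (tnth_nth 0%N) /= nth_rcons size_tuple ltnn eqxx.
Qed.

(** * Induction on the dimension *)

Section Induction.
Variables (R : realType) (a : nat -> R).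
Hypothesis ha : conditionally_convergent a.

(** The outermost index is held at [k]: [c] gives the increments of the outer partial sums. *)
Definition prescribes n (b : n.+1.-tuple nat -> R) (c : {perm 'I_n.+1} -> nat -> R) :=
  forall (s : {perm 'I_n.+1}) (k : nat), is_iterated_sum
    (fun t : n.-tuple nat => b [tuple tnth [tuple of k :: t] (s i) | i < n.+1]) (c s k).

Lemma prescribes_of_line_sums n (b : n.+2.-tuple nat -> R)
    (c : {perm 'I_n.+2} -> nat -> R) (L : 'I_n.+2 -> n.+1.-tuple nat -> R) :
  (forall d x, series (fun t => b (insert d x t)) @ \oo --> L d x) ->
  (forall d, prescribes (L d) (fun s => c (lift_perm d ord_max s))) ->
  prescribes b c.
Proof.
move=> bL Lc s k; have [s' ->] := lift_perm_surj (permKV s ord_max).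
(* The coordinate of [b] that carries the innermost variable. *)
set d := (s^-1)%g _.
apply: is_iterated_sum_rcons (Lc d s' k) => t.
rewrite (_ : (fun u => _) =
  fun u => b (insert d [tuple tnth [tuple of k :: t] (s' i) | i < n.+1] u)).
  exact: bL.
apply/funext => u; rewrite -tuple_perm_rcons; congr b.
by apply: eq_from_tnth => i; rewrite !tnth_mktuple !(tnth_nth 0%N).
Qed.


(** The line sums [L] may be arbitrary reals, so [step] asks the lower dimension only for
    [prescribes], which is trivial in dimension 1. *)
Lemma exists_rearrangement_prescribing n (c : {perm 'I_n.+2} -> nat -> R) :
  exists b : n.+2.-tuple nat -> R, is_rearrangement a b /\ prescribes b c.
Proof.
have step m (e : {perm 'I_m.+2} -> nat -> R) :
  (forall e' : {perm 'I_m.+1} -> nat -> R, exists b, prescribes b e') ->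
  exists b : m.+2.-tuple nat -> R, is_rearrangement a b /\ prescribes b e.
  move=> IH; have /choice [L HL] := fun d => IH (fun s => e (lift_perm d ord_max s)).
  have [b [ab bL]] := rearrangement_with_line_sums ha L.
  by exists b; split=> //; exact: prescribes_of_line_sums bL HL.
apply: (step) => {c}; elim: n => [|n IH] c.
  exists (fun t => c 1%g (tnth t ord0)) => s k /=.
  rewrite tnth_mktuple (_ : s = 1%g) //.
    by rewrite (ord1 (_ ord0)).
  by apply/permP => i; rewrite !ord1.
by have [b []] := step _ c IH; exists b.
Qed.

End Induction.

Theorem theorem1 (R : realType) (n : nat) (hn : (2 <= n)%N)
    (a : nat -> R) (ha : conditionally_convergent a)
    (s : {perm 'I_n} -> nat -> R) :
  exists b : n.-tuple nat -> R,
    is_rearrangement a b /\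
    forall (sigma : {perm 'I_n}) (k : nat), (1 <= k)%N ->
      is_iterated_psum k
        (fun j : n.-tuple nat => b [tuple tnth j (sigma i) | i < n])
        (s sigma k).
Proof.
case: n hn s => [//|[//|n]] _ s.
(* The empty partial sum is 0; the increments of [s0] then telescope to [s sigma k]. *)
pose s0 sigma k := if k is 0 then 0 else s sigma k.
have [b [ab bc]] := exists_rearrangement_prescribing ha
  (fun sigma k => s0 sigma k.+1 - s0 sigma k).
exists b; split=> // sigma k k0; exists (fun j => s0 sigma j.+1 - s0 sigma j).
split=> [j _|]; first exact: bc.
by rewrite telescope_sumr //= subr0; case: k k0.
Qed.
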